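(* Let $n\ge 2$, let $m>0$, and let $f_{n-1}(\phi)$ be a real trigonometric polynomial of degree $n-1$ which is nonnegative on $\mathbb{R}$ with minimum value $0$. Put $f(\phi)=(\cos\phi+1)(f_{n-1}(\phi)+m)$ and $\bar f(\phi)=(\cos\phi+1)f_{n-1}(\phi)$. Then (a) $f\in C_n$ if and only if $\bar f\in C_n$; (b) if $f\in C_n$, then $v(f)>v(\bar f)$.
   Context: For an integer $n\ge 2$, $C_n$ denotes the set of real cosine polynomials $f(\phi)=\sum_{k=0}^{n} a_k\cos(k\phi)$ such that (i) all coefficients $a_0,\dots,a_n$ are real and nonnegative, (ii) $a_1>a_0>0$, and (iii) $f(\phi)\ge 0$ for all real $\phi$. For $f\in C_n$ with coefficients $a_k$, $v(f)=\dfrac{f(0)-a_0}{(\sqrt{a_1}-\sqrt{a_0})^2}$. *)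

(* Defs.v *)
From mathcomp Require Import all_boot all_order all_algebra.
From mathcomp Require Import all_classical all_reals all_analysis.
Set Implicit Arguments.
Unset Strict Implicit.
Unset Printing Implicit Defensive.
Import Order.TTheory GRing.Theory Num.Theory.
Local Open Scope classical_set_scope.
Local Open Scope ring_scope.

(* Coefficient families are functions on nat; a cosine polynomial of degree at
   most n only looks at the indices 0, ..., n. *)
Definition cos_poly (R : realType) (n : nat) (a : nat -> R) (x : R) : R :=
  \sum_(0 <= k < n.+1) a k * cos (k%:R * x).

Definition C_ (R : realType) (n : nat) : set (R -> R) :=
  [set f | exists a : nat -> R,
    [/\ f = cos_poly n a,
        forall k : nat, (k <= n)%N -> 0 <= a k,
        a 0%N < a 1%N,
        0 < a 0%N
      & forall x : R, 0 <= f x]].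

(* The values at k <= n are determined by f when f is a cosine polynomial of
   degree at most n, since the functions cos (k x) are linearly independent;
   the values at k > n, and the result on other functions, are junk. *)
Definition cos_coef (R : realType) (n : nat) (f : R -> R) : nat -> R :=
  xget (fun=> 0) [set a | f = cos_poly n a].

Definition v (R : realType) (n : nat) (f : R -> R) : R :=
  let a := cos_coef n f in
  (f 0 - a 0%N) / (Num.sqrt (a 1%N) - Num.sqrt (a 0%N)) ^+ 2.

Definition trig_poly (R : realType) (d : nat) (a b : nat -> R) (x : R) : R :=
  \sum_(0 <= k < d.+1) a k * cos (k%:R * x) +
  \sum_(1 <= k < d.+1) b k * sin (k%:R * x).

(* Exact degree d; b 0 does not occur in trig_poly, hence the test 0 < d. *)
Definition is_trig_poly_of_degree (R : realType) (d : nat) (g : R -> R) : Prop :=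
  exists a b : nat -> R,
    g = trig_poly d a b /\ (a d != 0 \/ ((0 < d)%N /\ b d != 0)).

Definition is_min_value (R : realType) (g : R -> R) (c : R) : Prop :=
  (forall x : R, c <= g x) /\ (exists x : R, g x = c).

(* Main.v *)
Require Import Defs.
From mathcomp Require Import all_boot all_order all_algebra.
From mathcomp Require Import all_classical all_reals all_analysis.
From mathcomp Require Import ring lra.
Set Implicit Arguments.
Unset Strict Implicit.
Unset Printing Implicit Defensive.
Import Order.TTheory GRing.Theory Num.Theory.
Local Open Scope classical_set_scope.
Local Open Scope ring_scope.

(* Since [f = fbar + m (1 + cos)], only the coefficients [a 0] and [a 1] differ
   between [f] and [fbar], both by [m].  Membership passes from [f] to [fbar]
   because a nonnegative cosine polynomial satisfies [a 1 <= 2 a 0], so that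
   [a 0 < a 1] already forces [0 < a 0].  Adding [m] to both coefficients
   increases [f 0 - a 0] by [m] and shrinks the gap
   [sqrt (a 1) - sqrt (a 0) = (a 1 - a 0) / (sqrt (a 1) + sqrt (a 0))], so it
   increases [v].  The coefficients [a 0] and [a 1] are read off from the values
   at [n + 2] equally spaced points, by discrete orthogonality. *)

Definition node (R : realType) (N j : nat) : R := j%:R * (2 * pi / N%:R).

(* Multiplying by [2 sin (k pi / N)] makes the sum telescope. *)
Lemma sum_cos_node (R : realType) (N k : nat) : (0 < k < N)%N ->
  \sum_(0 <= j < N) cos (k%:R * node R N j) = 0.
Proof.
move=> /andP[k_gt0 ltkN].
have N_gt0 : 0 < N%:R :> R by rewrite ltr0n (leq_trans _ ltkN).
pose h : R := k%:R * pi / N%:R.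
have sin_h : 0 < sin h.
  apply: sin_gt0_pi; rewrite /h divr_gt0 ?mulr_gt0 ?pi_gt0 ?N_gt0 ?ltr0n //=.
  by rewrite ltr_pdivrMr // mulrC ltr_pM2l ?pi_gt0 // ltr_nat.
suff: 2 * sin h * \sum_(0 <= j < N) cos (k%:R * node R N j) = 0.
  by move/eqP; rewrite !mulf_eq0 pnatr_eq0 /= (gt_eqF sin_h) /= => /eqP.
pose u (j : nat) : R := sin (j%:R * (2 * h) - h).
rewrite mulr_sumr (eq_bigr (fun j => u j.+1 - u j)); last first.
  move=> j _; rewrite /u.
  have -> : j.+1%:R * (2 * h) - h = j%:R * (2 * h) + h by rewrite -natr1; ring.
  have -> : k%:R * node R N j = j%:R * (2 * h) by rewrite /node /h; ring.
  by rewrite sinD sinB; ring.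
rewrite telescope_sumr // /u mul0r sub0r.
(* The arguments of the last and first terms, [u N] and [u 0], differ by [k] full periods, so these
   terms cancel. *)
have -> : N%:R * (2 * h) - h = - h + (pi *+ 2) *+ k.
  by rewrite /h -[_ *+ k]mulr_natr -[_ *+ 2]mulr_natr; field; rewrite gt_eqF.
by rewrite (periodicn (@sinD2pi R)) subrr.
Qed.

(** By the product-to-sum formula this is half the node sums at frequencies [k + 1] and [k - 1].
    Both vanish unless [k = 1], when the frequency 0 contributes [N]. The case [k = 0], where
    [k - 1] is negative, is a single node sum at frequency 1. *)
Lemma sum_cos_cos_node (R : realType) (N k : nat) : (2 < N)%N -> (k.+1 < N)%N ->
  \sum_(0 <= j < N) cos (k%:R * node R N j) * cos (node R N j) =
  (k == 1%N)%:R * (N%:R / 2).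
Proof.
move=> N_gt2; case: k => [|k] ltkN.
  rewrite mul0r -[RHS](@sum_cos_node R N 1) ?ltkN //.
  by apply: eq_bigr => j _; rewrite mul0r cos0 !mul1r.
rewrite (eq_bigr (fun j => 2^-1 * cos (k.+2%:R * node R N j) +
                           2^-1 * cos (k%:R * node R N j))); last first.
  move=> j _; set x := node R N j.
  have -> : k.+2%:R * x = k.+1%:R * x + x by rewrite -natr1; ring.
  have -> : k%:R * x = k.+1%:R * x - x by rewrite -natr1; ring.
  by rewrite cosD cosB; field.
rewrite big_split /= -!mulr_sumr sum_cos_node // mulr0 add0r.
case: k ltkN => [|k] ltkN.
  rewrite (eq_bigr (fun=> 1)); last by move=> j _; rewrite mul0r cos0.
  by rewrite sumr_const_nat subn0 eqxx mul1r mulrC.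
by rewrite sum_cos_node ?mulr0 ?mul0r // (ltn_trans _ ltkN).
Qed.

Lemma cos_poly_coef0 (R : realType) (n : nat) (a : nat -> R) :
  \sum_(0 <= j < n.+2) cos_poly n a (node R n.+2 j) = n.+2%:R * a 0%N.
Proof.
rewrite exchange_big /= big_nat_recl // [X in _ + X]big_nat [X in _ + X]big1 => [|k /andP[_ ltkn]].
  rewrite addr0 (eq_bigr (fun=> a 0%N)); last first.
    by move=> j _; rewrite mul0r cos0 mulr1.
  by rewrite sumr_const_nat subn0 mulr_natl.
by rewrite -mulr_sumr sum_cos_node ?mulr0 //= ltnS ltnW.
Qed.

(** Multiplying by the cosine produces frequencies up to [n + 1]; with [n + 2] nodes these stay
    below the number of nodes, so none is aliased to 0. *)
Lemma cos_poly_coef1 (R : realType) (n : nat) (a : nat -> R) : (0 < n)%N ->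
  \sum_(0 <= j < n.+2) cos_poly n a (node R n.+2 j) * cos (node R n.+2 j) =
  n.+2%:R / 2 * a 1%N.
Proof.
move=> n_gt0.
rewrite (eq_bigr (fun j => \sum_(0 <= k < n.+1)
  a k * (cos (k%:R * node R n.+2 j) * cos (node R n.+2 j)))); last first.
  by move=> j _; rewrite mulr_suml; apply: eq_bigr => k _; rewrite mulrA.
rewrite exchange_big /= (eq_big_nat _ _ (F2 := fun k =>
  a k * ((k == 1%N)%:R * (n.+2%:R / 2)))); last first.
  by move=> k /andP[_ ltkn]; rewrite -mulr_sumr sum_cos_cos_node.
case: n n_gt0 => // n _.
rewrite big_nat_recl // mul0r mulr0 add0r big_nat_recl // big1 => [|k _].
  by rewrite addr0 mul1r mulrC.
by rewrite mul0r mulr0.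
Qed.

(** Weighting the nonnegative values at the nodes by [cos <= 1] can only lower their sum. *)
Lemma nonneg_cos_poly_coef_le (R : realType) (n : nat) (a : nat -> R) :
  (0 < n)%N -> (forall x, 0 <= cos_poly n a x) -> a 1%N <= 2 * a 0%N.
Proof.
move=> n_gt0 a_ge0.
have N2_gt0 : 0 < n.+2%:R / 2 :> R by rewrite divr_gt0.
rewrite -(ler_pM2l N2_gt0) -cos_poly_coef1 // mulrA divfK // -cos_poly_coef0.
by apply: ler_sum => j _; rewrite ler_piMr // cos_le1.
Qed.

(** Node sums depend only on the function, so any two families representing it agree at 0 and 1, the
    indices that [v] reads. *)
Lemma cos_coef_cos_poly (R : realType) (n : nat) (a : nat -> R) : (0 < n)%N ->
  cos_coef n (cos_poly n a) 0%N = a 0%N /\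
  cos_coef n (cos_poly n a) 1%N = a 1%N.
Proof.
move=> n_gt0; set b := cos_coef n _.
have ab : cos_poly n a = cos_poly n b.
  (* The family [a] itself witnesses that the default of [xget] is not returned. *)
  exact: (@xgetI _ (fun=> 0) [set b | cos_poly n a = cos_poly n b] a erefl).
have N_neq0 : n.+2%:R != 0 :> R by rewrite pnatr_eq0.
have N2_neq0 : n.+2%:R / 2 != 0 :> R by rewrite mulf_neq0 // invr_eq0.
split.
  by apply: (mulfI N_neq0); rewrite -!cos_poly_coef0 ab.
by apply: (mulfI N2_neq0); rewrite -!cos_poly_coef1 // ab.
Qed.

Lemma cos_poly_at0 (R : realType) (n : nat) (a : nat -> R) :
  cos_poly n a 0 = a 0%N + \sum_(0 <= k < n) a k.+1.
Proof.
rewrite /cos_poly big_nat_recl // mulr0 cos0 mulr1; congr (_ + _).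
by apply: eq_bigr => k _; rewrite mulr0 cos0 mulr1.
Qed.

Lemma v_cos_poly (R : realType) (n : nat) (a : nat -> R) : (0 < n)%N ->
  v n (cos_poly n a) = (\sum_(0 <= k < n) a k.+1) /
                       (Num.sqrt (a 1%N) - Num.sqrt (a 0%N)) ^+ 2.
Proof.
move=> n_gt0; rewrite /v; have [-> ->] := cos_coef_cos_poly a n_gt0.
by rewrite cos_poly_at0 addrC addKr.
Qed.

Definition shift01 (R : realType) (c : R) (a : nat -> R) (k : nat) : R :=
  if (k <= 1)%N then a k + c else a k.

Lemma cos_poly_shift01 (R : realType) (n : nat) (c : R) (a : nat -> R) (x : R) :
  (0 < n)%N -> cos_poly n (shift01 c a) x = cos_poly n a x + (cos x + 1) * c.
Proof.
case: n => // n _; rewrite /cos_poly !(big_nat_recl n.+1, big_nat_recl n) //.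
rewrite /shift01 /=.
by rewrite mul0r cos0 mul1r; ring.
Qed.

Lemma sqrt_gap_shift (R : realType) (x y m : R) : 0 < m -> 0 <= x -> x < y ->
  0 < Num.sqrt (y + m) - Num.sqrt (x + m) < Num.sqrt y - Num.sqrt x.
Proof.
move=> m_gt0 x_ge0 ltxy.
have ltxm : Num.sqrt x < Num.sqrt (x + m) by rewrite ltr_sqrt; lra.
have ltym : Num.sqrt y < Num.sqrt (y + m) by rewrite ltr_sqrt; lra.
have ltxym : Num.sqrt (x + m) < Num.sqrt (y + m) by rewrite ltr_sqrt; lra.
have := sqrtr_ge0 x; have := sqrtr_ge0 y.
have := @sqr_sqrtr _ x ltac:(lra); have := @sqr_sqrtr _ y ltac:(lra).
have := @sqr_sqrtr _ (x + m) ltac:(lra).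
have := @sqr_sqrtr _ (y + m) ltac:(lra).
move: (Num.sqrt x) (Num.sqrt y) (Num.sqrt (x + m)) (Num.sqrt (y + m))
  ltxm ltym ltxym => p q p' q' ltpp' ltqq' ltp'q' q'2 p'2 q2 p2 q_ge0 p_ge0.
rewrite subr_gt0 ltp'q' /=.
(* Both sides equal [y - x]; multiplying the goal by [q' + p'] then reduces it to
   [q + p < q' + p']. *)
have gapE : (q' - p') * (q' + p') = (q - p) * (q + p).
  by rewrite -!subr_sqr; lra.
rewrite -(@ltr_pM2r _ (q' + p')); last lra.
rewrite gapE ltr_pM2l; last by nra.
lra.
Qed.

Lemma v_shift01_gt (R : realType) (n : nat) (m : R) (a : nat -> R) :
  (0 < n)%N -> 0 < m -> (forall k, (k <= n)%N -> 0 <= a k) ->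
  a 0%N < a 1%N -> v n (cos_poly n a) < v n (cos_poly n (shift01 m a)).
Proof.
move=> n_gt0 m_gt0 a_ge0 lta01; rewrite !v_cos_poly //.
have sumE : \sum_(0 <= k < n) shift01 m a k.+1 = \sum_(0 <= k < n) a k.+1 + m.
  by case: (n) n_gt0 => // p _; rewrite !big_nat_recl //= addrAC.
have sum_ge0 : 0 <= \sum_(0 <= k < n) a k.+1.
  by rewrite big_nat sumr_ge0 // => k /andP[_ /a_ge0].
rewrite sumE /shift01 /=.
have /andP[gap_gt0 gap_lt] := sqrt_gap_shift m_gt0 (a_ge0 0%N isT) lta01.
have gap'_gt0 := lt_trans gap_gt0 gap_lt.
(* Shrinking the denominator under the old numerator gives a weak inequality; adding [m] to the
   numerator makes it strict. *)
apply: (@le_lt_trans _ _ ((\sum_(0 <= k < n) a k.+1) /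
  (Num.sqrt (a 1%N + m) - Num.sqrt (a 0%N + m)) ^+ 2)).
  rewrite ler_wpM2l // lef_pV2 ?posrE ?exprn_gt0 //.
  by rewrite lerXn2r ?nnegrE ?ltW.
by rewrite ltr_pM2r ?invr_gt0 ?exprn_gt0 // ltrDl.
Qed.

Theorem theorem2p4 (R : realType) (n : nat) (hn : (2 <= n)%N)
    (m : R) (hm : 0 < m) (g : R -> R)
    (hdeg : is_trig_poly_of_degree n.-1 g)
    (hnonneg : forall x : R, 0 <= g x)
    (hmin : is_min_value g 0) :
  let f : R -> R := fun x => (cos x + 1) * (g x + m) in
  let fbar : R -> R := fun x => (cos x + 1) * g x in
  (C_ n f <-> C_ n fbar) /\ (C_ n f -> v n fbar < v n f).
Proof.
move=> f fbar.
have n_gt0 : (0 < n)%N by apply: leq_trans hn.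
have cos1_ge0 x : 0 <= cos x + 1 :> R by have := cos_geN1 x; lra.
have fbar_ge0 x : 0 <= fbar x by rewrite mulr_ge0.
have f_of_fbar a : fbar = cos_poly n a -> f = cos_poly n (shift01 m a).
  move=> fbarE; apply/funext => x.
  by rewrite cos_poly_shift01 // -fbarE /f /fbar mulrDr.
have C_fbar : C_ n f -> exists a, [/\ fbar = cos_poly n a,
    forall k, (k <= n)%N -> 0 <= a k, a 0%N < a 1%N & 0 < a 0%N].
  move=> [a [fE a_ge0 lta01 _ _]].
  have fbarE : fbar = cos_poly n (shift01 (- m) a).
    apply/funext => x.
    by rewrite cos_poly_shift01 // -fE /f /fbar; ring.
  have lt01 : shift01 (- m) a 0 < shift01 (- m) a 1 by rewrite /shift01 /=; lra.
  (* A priori [a 0 - m] might be negative. Nonnegativity of [fbar] excludes this: with [lt01], the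
     constant coefficient is less than its own double. *)
  have le12 : shift01 (- m) a 1 <= 2 * shift01 (- m) a 0.
    by apply: (nonneg_cos_poly_coef_le n_gt0) => x; rewrite -fbarE.
  exists (shift01 (- m) a); split=> //; last lra.
  case=> [|[|k]] lekn; [lra | lra | exact: a_ge0].
split; [split|].
- by move=> /C_fbar[a [fbarE a_ge0 lta01 a0_gt0]]; exists a.
- move=> [a [fbarE a_ge0 lta01 a0_gt0 _]].
  exists (shift01 m a); split.
  + exact: f_of_fbar.
  + by case=> [|[|k]] lekn; have := a_ge0 _ lekn; rewrite /shift01 /=; lra.
  + by rewrite /shift01 /=; lra.
  + by rewrite /shift01 /=; lra.
  + by move=> x; rewrite mulr_ge0 // addr_ge0 // ltW.
- move=> /C_fbar[a [fbarE a_ge0 lta01 a0_gt0]].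
  by rewrite (f_of_fbar a fbarE) fbarE; apply: v_shift01_gt.
Qed.
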